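(* Let $d\geq 1$, $r\geq d+1$, $1\leq m\leq r$ and $m\leq k\leq \min\{m+d,r\}$ be integers. Let $\mathcal{C}$ be a finite family of convex sets in $\mathbb{R}^d$, colored with $r$ different colors, with $|\mathcal{C}|\geq \max\{m+d,r\}$. Assume that for every subfamily $\{A_1,\ldots,A_d,B_1,\ldots,B_m\}\subset \mathcal{C}$ colored with at least $k$ different colors, at least one of the subfamilies $\{A_1,\ldots,A_d,B_i\}$, $i\in\{1,\ldots,m\}$, is intersecting. Then there are $r-k+1$ color classes whose union is intersecting.
   Context: A family of (not necessarily distinct) sets colored with $r$ colors is a partition $\mathcal{C}=\mathcal{C}_1\cup\cdots\cup\mathcal{C}_r$; the $\mathcal{C}_i$ are the color classes. A subfamily is intersecting if the intersection of all its members is nonempty. Subfamilies $\{A_1,\ldots,A_d,B_1,\ldots,B_m\}$ consist of $d+m$ distinct members of $\mathcal{C}$. *)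

(* Defs.v *)
(* A finite family of not necessarily distinct subsets of T is a map
   C : I -> set T on a finite index type I; members are distinct when their
   indices are, and a subfamily is a set J : {set I} of indices.  A coloring
   with r colors is a map c : I -> 'I_r. *)
From mathcomp Require Export all_boot all_order all_algebra.
From mathcomp Require Export classical_sets reals convex.

Set Implicit Arguments.
Unset Strict Implicit.
Unset Printing Implicit Defensive.

Definition intersecting (T : Type) (I : finType) (C : I -> set T)
    (J : {set I}) : Prop :=
  ((\bigcap_(i in [set` J]) C i) !=set0)%classic.

Definition color_class (I : finType) (r : nat) (c : I -> 'I_r) (j : 'I_r) :
    {set I} :=
  [set i | c i == j]%SET.

Definition color_union (I : finType) (r : nat) (c : I -> 'I_r)
    (S : {set 'I_r}) : {set I} :=
  (\bigcup_(j in S) color_class c j)%SET.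

Definition num_colors (I : finType) (r : nat) (c : I -> 'I_r)
    (J : {set I}) : nat :=
  #|(c @: J)%SET|.

(* Main.v *)
(** Shrink every C i to a polytope with the same intersection pattern, and let
    h J be the minimum of the squared Euclidean norm over the intersection
    indexed by J.  Call (A, B) spread when |A| = d, |B| = m, A and B are disjoint
    and their union has at least k colors.  Among spread pairs take one
    maximizing the minimum over b in B of h (b |: A); let t be this value,
    J := b |: A a set attaining it, p the minimizer on J, and M the set of
    indices of all members containing p.  By Helly's theorem some L in J with
    |L| <= d already has h L = t, and by strict convexity p is the only point
    of squared norm at most t common to the members of L.  If the complement of M
    misses r - k + 1 colors, these classes are all pierced by p.  Otherwise L
    extends to a spread pair (A', B') with B' outside M, and by maximality some
    b' |: A' with b' in B' has a common point of squared norm at most t; that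
    point is p, which contradicts b' not being in M. *)
Require Import Defs.
From mathcomp Require Import interval_inference boolp.
From mathcomp Require Import topology normedtype derive.
From mathcomp Require Import ring lra zify.
(* Gives the lemmas on {set T} precedence over their classical_sets namesakes. *)
Import fintype boot.finset.
Import Order.TTheory GRing.Theory Num.Theory.
Import numFieldNormedType.Exports.

Set Implicit Arguments.
Unset Strict Implicit.
Unset Printing Implicit Defensive.

(** * Finite sets with prescribed size and colors *)

Lemma subset_between (T : finType) (X Y : {set T}) (n : nat) :
  X \subset Y -> #|X| <= n -> n <= #|Y| ->
  exists Z : {set T}, [/\ X \subset Z, Z \subset Y & #|Z| = n].
Proof.
move=> sXY; elim: n => [|n IHn] leXn lenY.
  by exists X; split=> //; apply/eqP; rewrite -leqn0.
move: leXn; rewrite leq_eqVlt => /orP[/eqP eqX|/IHn []]; first by exists X.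
  exact: ltnW.
move=> Z [sXZ sZY eqZ].
have /properP[_ [y yY yZ]] : Z \proper Y.
  by rewrite properEcard sZY eqZ.
exists (y |: Z); split; first by rewrite (subset_trans sXZ) // subsetUr.
  by rewrite subUset sub1set yY.
by rewrite cardsU1 yZ eqZ.
Qed.

Lemma exists_transversal (T U : finType) (f : T -> U) (Y : {set T})
    (E : {set U}) :
  E \subset f @: Y ->
  exists X : {set T}, [/\ X \subset Y, f @: X = E & #|X| = #|E|].
Proof.
move=> /subsetP sE.
(* [rep] fixes one preimage in [Y] per value; [X] keeps only these, so [f] is injective on [X]. *)
pose rep u := [pick y in Y | f y == u].
pose X := [set x in Y | (f x \in E) && (rep (f x) == Some x)].
have fXE : f @: X = E.
  apply/setP=> u; apply/imsetP/idP => [[x]|uE].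
    by rewrite inE => /and3P[_ ? _] ->.
  have [x xE] : exists x, rep u = Some x.
    have /imsetP[y yY fy] := sE u uE.
    rewrite /rep; case: pickP => [x _|/(_ y)]; first by exists x.
    by rewrite yY fy eqxx.
  have [xY fx] : x \in Y /\ f x = u.
    by move: xE; rewrite /rep; case: pickP => // z /andP[zY /eqP fz] [<-].
  by exists x; rewrite // inE xY fx uE xE eqxx.
exists X; split=> //; first by apply/subsetP=> x; rewrite inE => /andP[].
rewrite -fXE card_in_imset // => x y.
rewrite !inE => /and3P[_ _ /eqP rx] /and3P[_ _ /eqP ry] fxy.
by apply: Some_inj; rewrite -rx -ry fxy.
Qed.

Definition spread (I : finType) (r : nat) (c : I -> 'I_r) (d m k : nat)
    (A B : {set I}) : bool :=
  [&& #|A| == d, #|B| == m, [disjoint A & B] & k <= num_colors c (A :|: B)].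

(** Each of the m + d - |L| indices outside [L] adds at most one color. This is the counting
    condition under which [exists_spread] can extend [L]. *)
Lemma spread_subset_bound (I : finType) (r : nat) (c : I -> 'I_r)
    (d m k : nat) (A B L : {set I}) :
  spread c d m k A B -> L \subset A :|: B ->
  #|L| + k <= m + d + num_colors c L.
Proof.
case/and4P=> /eqP cA /eqP cB dAB kAB sL.
have cAB : #|A :|: B| = m + d.
  by rewrite cardsU (disjoint_setI0 dAB) cards0 subn0 cA cB addnC.
have eqAB : c @: (A :|: B) = c @: L :|: c @: ((A :|: B) :\: L).
  by rewrite -imsetU setDE setUIr setUCr setIT (setUidPr sL).
have := cardsU (c @: L) (c @: ((A :|: B) :\: L)).
have := leq_imset_card c ((A :|: B) :\: L).
have := subset_leq_card sL.
move: kAB; rewrite /num_colors eqAB cardsDS // cAB.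
set x := #|_ :|: _|; set y := #|c @: L|; set z := #|c @: _|.
by move=> ? ? ? ?; lia.
Qed.

(** [B] is cut out of a subset [W] of [N] supplying the colors missing from [L]; [A] is the rest of
    a set [Z] of size m + d containing [L] and [W]. The last inequality, with |L| <= d, makes room
    for [W] in [Z]. *)
Lemma exists_spread (I : finType) (r : nat) (c : I -> 'I_r) (d m k : nat)
    (L N : {set I}) :
  m <= k -> k <= m + d -> m + d <= #|I| ->
  #|L| <= d -> [disjoint L & N] -> k <= num_colors c N ->
  #|L| + k <= m + d + num_colors c L ->
  exists A B : {set I}, [/\ spread c d m k A B, L \subset A & B \subset N].
Proof.
move=> lemk lekmd leI leLd dLN kN kL.
set n := num_colors c L in kL.
(* [E] consists of k - n colors of [N] new to [L]; the truncated difference is 0 once [L] alone has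
   k colors. *)
have [|||E [_ sE cE]] := @subset_between _ set0 (c @: N :\: c @: L) (k - n).
- exact: sub0set.
- by rewrite cards0.
- have := cardsID (c @: L) (c @: N).
  have := subset_leq_card (subsetIr (c @: N) (c @: L)).
  move: kN; rewrite /n /num_colors.
  by move=> ? ? ?; lia.
have [|U [sUN cU eU]] := @exists_transversal _ _ c N E.
  by apply: subset_trans sE _; exact: subsetDl.
have leN : k <= #|N| by apply: leq_trans kN _; exact: leq_imset_card.
(* [W] must hold the k - n elements of [U] and also m elements for [B]. *)
have [|||W [sUW sWN eW]] := @subset_between _ U N (maxn m (k - n)) => //.
- by rewrite eU cE leq_maxr.
- by rewrite geq_max (leq_trans lemk leN) (leq_trans _ leN) // leq_subr.
have [|||B [_ sBW eB]] := @subset_between _ set0 W m.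
- exact: sub0set.
- by rewrite cards0.
- by rewrite eW leq_maxl.
have dLW : [disjoint L & W] by rewrite disjoint_sym (disjointWl sWN) // disjoint_sym.
have [|||Z [sZ _ eZ]] := @subset_between _ (L :|: W) setT (m + d).
- exact: subsetT.
- rewrite cardsU (disjoint_setI0 dLW) cards0 eW.
  by rewrite subn0 addn_maxr geq_max; apply/andP; split; lia.
- by rewrite cardsT.
have [sLZ sWZ] : L \subset Z /\ W \subset Z by apply/andP; rewrite -subUset.
have sBZ : B \subset Z := subset_trans sBW sWZ.
exists (Z :\: B), B; split; last exact: subset_trans sBW sWN.
  apply/and4P; split.
  - by rewrite cardsDS // eZ eB addKn.
  - by rewrite eB.
  - by rewrite -setI_eq0 setIDAC setDIl setDv setI0.
  rewrite setDE setUIl (setUC (~: B)) setUCr setIT (setUidPl sBZ).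
  apply: (@leq_trans #|c @: L :|: E|).
    have dLE : [disjoint c @: L & E].
      rewrite disjoint_sym (disjointWl sE) //.
      by rewrite -setI_eq0 setDE -setIA (setIC (~: _)) setICr setI0.
    rewrite cardsU (disjoint_setI0 dLE) cards0 subn0 cE.
    by rewrite -/(num_colors c L) -/n; lia.
  apply: subset_leq_card; rewrite subUset imsetS //=.
  by rewrite -cU imsetS // (subset_trans sUW).
by rewrite subsetD sLZ (disjointWr sBW).
Qed.

(** At most k - 1 of the r colors occur in [N], so r - k + 1 can be chosen among the others. *)
Lemma exists_avoided_colors (I : finType) (r : nat) (c : I -> 'I_r) (k : nat)
    (N : {set I}) :
  k <= r -> num_colors c N < k ->
  exists2 S : {set 'I_r}, #|S| = r - k + 1 & color_union c S \subset ~: N.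
Proof.
move=> lekr ltNk.
have [|||S [_ sS eS]] := @subset_between _ set0 (~: (c @: N)) (r - k + 1).
- exact: sub0set.
- by rewrite cards0.
- have := cardsC (c @: N); rewrite card_ord.
  by move: ltNk; rewrite /num_colors => ? ?; lia.
exists S => //; apply/bigcupsP => j jS; apply/subsetP => i.
rewrite !inE => /eqP cij; apply/negP => iN.
have := subsetP sS j jS; rewrite inE -cij => /negP; apply.
exact: imset_f.
Qed.

Local Open Scope ring_scope.

(** * Convex combinations and Helly's theorem *)

Lemma convex_setP (R : realType) (V : lmodType R) (A : set V) :
  convex_set A <->
  forall x y (a b : R), A x -> A y -> 0 <= a -> 0 <= b -> a + b = 1 ->
    A (a *: x + b *: y).
Proof.
split=> [cA x y a b Ax Ay a0 b0 ab1|cA x y l].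
  have a1 : a <= 1 by rewrite -ab1 lerDl.
  have /andP[i0 i1] : (0 <= a) && (a <= 1) by rewrite a0.
  have := cA x y (Itv01 i0 i1); rewrite !in_setE => /(_ Ax Ay).
  rewrite /conv /=.
  by have -> : b = 1 - a by rewrite -ab1 addrC addKr.
rewrite !in_setE => Ax Ay; apply: cA => //; rewrite ?subr_ge0 //.
by rewrite addrC subrK.
Qed.

(** The weights are not normalized because their total may be 0; [z0] is the witness in that
    case. *)
Lemma convex_cone_sum (R : realType) (V : lmodType R) (A : set V)
    (n : finType) (P : pred n) (w : n -> R) (x : n -> V) (z0 : V) :
  convex_set A -> A z0 -> (forall i, P i -> 0 <= w i) ->
  (forall i, P i -> A (x i)) ->
  exists2 z, A z & \sum_(i | P i) w i *: x i = (\sum_(i | P i) w i) *: z.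
Proof.
move=> /convex_setP cA Az0 w0 Ax.
suff [] : 0 <= \sum_(i | P i) w i /\
  exists2 z, A z & \sum_(i | P i) w i *: x i = (\sum_(i | P i) w i) *: z by [].
elim/big_ind2: _ => [|u a v b [a0 [y Ay ->]] [b0 [z Az ->]]|i Pi].
- by split=> //; exists z0; rewrite ?scale0r.
- split; first exact: addr_ge0.
  have [ab0|abN0] := eqVneq (a + b) 0.
    move/eqP: ab0; rewrite paddr_eq0 // => /andP[/eqP -> /eqP ->].
    by exists z0; rewrite // addr0 !scale0r addr0.
  exists ((a / (a + b)) *: y + (b / (a + b)) *: z).
    by apply: cA => //; rewrite ?divr_ge0 ?addr_ge0 // -mulrDl divff.
  by rewrite scalerDr !scalerA !(mulrC (a + b)) !divfK.
- by split; [exact: w0|exists (x i); [exact: Ax|]].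
Qed.

Lemma convex_sum (R : realType) (V : lmodType R) (A : set V)
    (n : finType) (P : pred n) (w : n -> R) (x : n -> V) :
  convex_set A -> (forall i, P i -> 0 <= w i) ->
  (forall i, P i -> A (x i)) -> \sum_(i | P i) w i = 1 ->
  A (\sum_(i | P i) w i *: x i).
Proof.
move=> cA w0 Ax w1.
have [i Pi|P0] := pickP P; last first.
  by move: w1; rewrite big_pred0 // => /esym/eqP; rewrite oner_eq0.
have [z Az ->] := convex_cone_sum cA (Ax i Pi) w0 Ax.
by rewrite w1 scale1r.
Qed.

Lemma sumr_ge0_exists_gt0 (R : realDomainType) (n : finType) (a : n -> R) :
  (exists i, a i != 0) -> 0 <= \sum_i a i -> exists i, 0 < a i.
Proof.
move=> [i ai] s0; apply/existsP; apply: contraT.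
rewrite negb_exists => /forallP aN.
have a_le0 j : 0 <= - a j by rewrite oppr_ge0 leNgt aN.
have /eqP : \sum_j - a j = 0.
  apply/eqP; rewrite eq_le sumr_ge0 // andbT.
  by rewrite sumrN oppr_le0.
rewrite psumr_eq0 // => /allP /(_ i (mem_index_enum _)) /=.
by rewrite oppr_eq0 (negPf ai).
Qed.

(** More than d vectors [x i - y] are linearly dependent, and a change of sign makes the sum
    nonnegative. In the resulting affine relation [y] lies on the side opposite to the positive
    coefficients. *)
Lemma affine_dependence (R : realType) (d n : nat) (x : 'I_n -> 'rV[R]_d)
    (y : 'rV[R]_d) : (d < n)%N ->
  exists a : 'I_n -> R, [/\ exists i, 0 < a i, 0 <= \sum_i a i &
    \sum_i a i *: (x i - y) = 0].
Proof.
move=> ltdn; pose M := \matrix_i (x i - y).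
have : kermx M != 0.
  rewrite kermx_eq0 -row_leq_rank -ltnNge.
  by apply: leq_ltn_trans ltdn; exact: rank_leq_col.
case/rowV0Pn => u /sub_kermxP uM uN0.
have uE : \sum_i u 0 i *: (x i - y) = 0.
  rewrite -[RHS]uM mulmx_sum_row; apply: eq_bigr => i _.
  by rewrite rowK.
have [i ui] : exists i, u 0 i != 0 by apply/rV0Pn.
have [s0|s0] := leP 0 (\sum_i u 0 i).
  by exists (u 0); split=> //; apply: sumr_ge0_exists_gt0 => //; exists i.
exists (fun i => - u 0 i).
have s0' : 0 <= \sum_i - u 0 i by rewrite sumrN oppr_ge0 ltW.
split=> //.
  by apply: sumr_ge0_exists_gt0 => //; exists i; rewrite oppr_eq0.
by under eq_bigr do rewrite scaleNr; rewrite sumrN uE oppr0.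
Qed.

(** The witness is a Radon point. It is a convex combination of the [x i] with [0 < a i], hence in
    [G] and in each [K j] with [a j <= 0]. It is also one of [y] and the other [x i], hence in each
    [K j] with [0 < a j]. *)
Lemma convex_common_point (R : realType) (d n : nat)
    (K : 'I_n -> set 'rV[R]_d) (G : set 'rV[R]_d) (x : 'I_n -> 'rV[R]_d)
    (y : 'rV[R]_d) :
  (d < n)%N -> (forall i, convex_set (K i)) -> convex_set G ->
  (forall i, K i y) -> (forall i, G (x i)) ->
  (forall i j, j != i -> K j (x i)) ->
  exists2 z, G z & forall i, K i z.
Proof.
move=> ltdn cK cG Ky Gx Kx.
have [a [[i0 ai0] s0 ax0]] := affine_dependence x y ltdn.
pose s := \sum_i a i; rewrite -/s in s0.
pose p := \sum_(i | 0 < a i) a i.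
pose q := \sum_(i | ~~ (0 < a i)) - a i.
have p_gt0 : 0 < p.
  rewrite /p (bigD1 i0) //= ltr_wpDr // sumr_ge0 // => i /andP[/ltW].
  by [].
have pE : p = q + s.
  rewrite /s (bigID (fun i => 0 < a i)) /= -/p /q sumrN.
  by rewrite addrCA addNr addr0.
have sumE : \sum_(i | 0 < a i) a i *: x i =
    s *: y + \sum_(i | ~~ (0 < a i)) (- a i) *: x i.
  move: ax0; under eq_bigr do rewrite scalerBr.
  rewrite sumrB -scaler_suml -/s => /subr0_eq <-.
  rewrite [X in X + _](bigID (fun i => 0 < a i)) /= -addrA -big_split /=.
  by rewrite [X in _ + X]big1 ?addr0 // => i _; rewrite scaleNr subrr.
have w1 : \sum_(i | 0 < a i) a i / p = 1 by rewrite -mulr_suml divff ?gt_eqF.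
have zE : \sum_(i | 0 < a i) (a i / p) *: x i =
    p^-1 *: \sum_(i | 0 < a i) a i *: x i.
  by rewrite scaler_sumr; apply: eq_bigr => i _; rewrite scalerA mulrC.
have w0 i : 0 < a i -> 0 <= a i / p by move=> ?; rewrite divr_ge0 // ltW.
exists (\sum_(i | 0 < a i) (a i / p) *: x i); first exact: convex_sum.
move=> j; have [aj|ajN] := boolP (0 < a j); last first.
  apply: convex_sum => // i ai; apply: Kx.
  by apply: contraNneq ajN => ->.
have [||z Kz eqz] := @convex_cone_sum _ _ (K j) _ (fun i => ~~ (0 < a i))
    (fun i => - a i) x y (cK j) (Ky j).
- by move=> i; rewrite -leNgt oppr_ge0.
- by move=> i aiN; apply: Kx; apply: contraNneq aiN => <-.
rewrite zE sumE eqz -/q scalerDr !scalerA.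
have q0 : 0 <= q by apply: sumr_ge0 => i; rewrite -leNgt oppr_ge0.
have pi0 : 0 <= p^-1 by rewrite invr_ge0 ltW.
move/convex_setP: (cK j); apply=> //; rewrite ?mulr_ge0 //.
by rewrite -mulrDr addrC -pE mulVf ?gt_eqF.
Qed.

(* Helly's theorem for the members of J together with G: since J alone is
   intersecting, the d + 1 sets without a common point must include G. *)
Lemma relative_helly (R : realType) (d : nat) (I : finType)
    (C : I -> set 'rV[R]_d) (G : set 'rV[R]_d) (J : {set I}) :
  (forall i, convex_set (C i)) -> convex_set G -> intersecting C J ->
  (forall z, (forall i, i \in J -> C i z) -> ~ G z) ->
  exists L : {set I}, [/\ L \subset J, (#|L| <= d)%N &
    forall z, (forall i, i \in L -> C i z) -> ~ G z].
Proof.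
move=> cC cG; have [n] := ubnP #|J|; elim: n J => // n IHn J leJn [y Jy] JG.
have [leJd|ltdJ] := leqP #|J| d; first by exists J.
have [[i [iJ iG]]|NG] := pselect (exists i, i \in J /\
    forall z, (forall j, j \in J :\ i -> C j z) -> ~ G z).
  have [||L [sL cL LG]] := IHn (J :\ i) _ _ iG.
  - by move: leJn; rewrite (cardsD1 i J) iJ.
  - by exists y => j /= /setD1P[_ jJ]; exact: Jy.
  - by exists L; split=> //; exact: subset_trans sL (subsetDl _ _).
have pt (u : 'I_#|J|) : exists z, G z /\
    forall j, j \in J :\ enum_val u -> C j z.
  apply/not_existsP => H; apply: NG; exists (enum_val u).
  split=> [|z Kz Gz]; first exact: enum_valP.
  by apply: (H z).
have [x xP] := choice pt.
have [||||z Gz Kz] := @convex_common_point R d #|J| (fun u => C (enum_val u))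
    G x y ltdJ _ cG.
- by move=> i; exact: cC.
- by move=> i; apply: Jy; exact: enum_valP.
- by move=> i; case: (xP i).
- move=> i j jNi; case: (xP i) => _; apply.
  by rewrite in_setD1 enum_valP (inj_eq enum_val_inj) jNi.
case: (JG z) => // i iJ.
by rewrite -(enum_rankK_in iJ iJ); exact: Kz.
Qed.

(** * Strict convexity and continuity of the squared norm *)

Definition sqnorm (R : realType) (d : nat) (x : 'rV[R]_d) : R :=
  \sum_j x 0 j ^+ 2.

Lemma sqnorm_comb (R : realType) (d : nat) (x y : 'rV[R]_d) (a b : R) :
  a + b = 1 ->
  sqnorm (a *: x + b *: y) =
    a * sqnorm x + b * sqnorm y - a * b * sqnorm (x - y).
Proof.
move=> ab1; have -> : b = 1 - a by rewrite -ab1 addrC addKr.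
rewrite /sqnorm !mulr_sumr -sumrN -!big_split /=.
by apply: eq_bigr => j _; rewrite !mxE; ring.
Qed.

Lemma sqnorm_ge0 (R : realType) (d : nat) (x : 'rV[R]_d) : 0 <= sqnorm x.
Proof. by apply: sumr_ge0 => j _; exact: sqr_ge0. Qed.

Lemma sqnorm_le0 (R : realType) (d : nat) (x : 'rV[R]_d) :
  sqnorm x <= 0 -> x = 0.
Proof.
move=> x0; have /eqP : sqnorm x = 0 by apply/eqP; rewrite eq_le x0 sqnorm_ge0.
rewrite psumr_eq0 => [/allP xj|j _]; last exact: sqr_ge0.
apply/rowP => j; have := xj j (mem_index_enum _).
by rewrite sqrf_eq0 mxE => /eqP.
Qed.

Lemma convex_sqnorm_ball (R : realType) (d : nat) (t : R) :
  convex_set ([set x : 'rV[R]_d | sqnorm x < t])%classic.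
Proof.
apply/convex_setP => x y a b /= xt yt a0 b0 ab1.
rewrite sqnorm_comb //.
have q0 : 0 <= a * b * sqnorm (x - y) by rewrite !mulr_ge0 // sqnorm_ge0.
apply: (@le_lt_trans _ _ (a * sqnorm x + b * sqnorm y)); first by rewrite gerBl.
have -> : t = a * t + b * t by rewrite -mulrDl ab1 mul1r.
have [a00|aN0] := eqVneq a 0.
  by move: ab1; rewrite a00 add0r => ->; rewrite !mul0r !mul1r !add0r.
by rewrite ltr_leD ?(ler_wpM2l b0) ?(ltW yt) // ltr_pM2l ?xt // lt_def aN0.
Qed.

(** The midpoint has squared norm at most t - |x - y|^2 / 4, which falls below t unless x = y. *)
Lemma sqnorm_min_unique (R : realType) (d : nat) (K : set 'rV[R]_d) (t : R)
    (x y : 'rV[R]_d) :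
  convex_set K -> (forall z, K z -> t <= sqnorm z) ->
  K x -> K y -> sqnorm x <= t -> sqnorm y <= t -> x = y.
Proof.
move=> /convex_setP cK Kt Kx Ky xt yt.
apply/eqP; rewrite -subr_eq0; apply/eqP; apply: sqnorm_le0.
have h0 : 0 <= 2^-1 :> R by rewrite invr_ge0.
have h1 : 2^-1 + 2^-1 = 1 :> R by field.
have := Kt _ (cK x y _ _ Kx Ky h0 h0 h1); rewrite sqnorm_comb //.
by lra.
Qed.

Lemma continuous_sqnorm (R : realType) (d : nat) :
  continuous (@sqnorm R d).
Proof.
apply: continuous_big => [|j _]; first exact: add_continuous.
move=> x; under eq_fun do rewrite expr2.
by apply: continuousM; exact: coord_continuous.
Qed.

(** * Polytopes and compactness *)

(** The bound [(P i)%:R] kills the weights outside [P], so the weight vectors form a closed part of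
    a box, which gives compactness. *)
Definition hull (R : realType) (d n : nat) (P : pred 'I_n)
    (x : 'I_n -> 'rV[R]_d) : set 'rV[R]_d :=
  ([set z | exists w : 'rV[R]_n,
    [/\ forall i, 0 <= w 0 i <= (P i)%:R, \sum_i w 0 i = 1 &
      z = \sum_i w 0 i *: x i]])%classic.

Lemma compact_hull (R : realType) (d n : nat) (P : pred 'I_n)
    (x : 'I_n -> 'rV[R]_d) : compact (hull P x).
Proof.
pose W := ([set w : 'rV[R]_n | forall i, `[0%R, (P i)%:R]%classic (w 0 i)])%classic.
pose S := ([set w : 'rV[R]_n | \sum_i w 0 i = 1])%classic.
pose f (w : 'rV[R]_n) := \sum_i w 0 i *: x i.
have -> : hull P x = (f @` (W `&` S))%classic.
  apply/seteqP; split=> z.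
    by move=> [w [w0 w1 ->]]; exists w.
  by move=> [w [w0 w1] <-]; exists w.
apply: continuous_compact.
  apply: continuous_subspaceT; apply: continuous_big => [|i _].
    exact: add_continuous.
  by move=> w; apply: continuousZr_tmp; exact: coord_continuous.
apply: compact_closedI.
  apply: (@rV_compact R n (fun i => `[0%R, (P i)%:R]%classic)) => i.
  exact: segment_compact.
apply: (@preimage_closed _ _ (fun w : 'rV[R]_n => \sum_i w 0 i) [set 1]%classic).
  move=> w _; apply: continuous_big => [|i _]; first exact: add_continuous.
  exact: coord_continuous.
exact: closed_eq.
Qed.

Lemma convex_hull (R : realType) (d n : nat) (P : pred 'I_n)
    (x : 'I_n -> 'rV[R]_d) : convex_set (hull P x).
Proof.
apply/convex_setP => _ _ a b [u [u0 u1 ->]] [v [v0 v1 ->]] a0 b0 ab1.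
exists (a *: u + b *: v); split.
- move=> i; rewrite !mxE.
  have /andP[ui0 ui1] := u0 i; have /andP[vi0 vi1] := v0 i.
  rewrite addr_ge0 ?mulr_ge0 //=.
  have -> : (P i)%:R = a * (P i)%:R + b * (P i)%:R :> R.
    by rewrite -mulrDl ab1 mul1r.
  by rewrite lerD // ler_wpM2l.
- under eq_bigr do rewrite !mxE.
  by rewrite big_split /= -!mulr_sumr u1 v1 !mulr1.
- rewrite !scaler_sumr -big_split; apply: eq_bigr => i _.
  by rewrite !mxE scalerDl !scalerA.
Qed.

Lemma mem_hull (R : realType) (d n : nat) (P : pred 'I_n)
    (x : 'I_n -> 'rV[R]_d) (i : 'I_n) : P i -> hull P x (x i).
Proof.
move=> Pi; exists (delta_mx 0 i); split.
- move=> j; rewrite mxE eqxx /=; have [->|_] := eqVneq j i.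
    by rewrite Pi lexx ler01.
  by rewrite lexx ler0n.
- rewrite (bigD1 i) //= mxE !eqxx big1 ?addr0 // => j ji.
  by rewrite mxE (negPf ji) andbF.
- rewrite (bigD1 i) //= mxE !eqxx scale1r big1 ?addr0 // => j ji.
  by rewrite mxE (negPf ji) andbF scale0r.
Qed.

Lemma hull_sub (R : realType) (d n : nat) (P : pred 'I_n)
    (x : 'I_n -> 'rV[R]_d) (A : set 'rV[R]_d) :
  convex_set A -> (forall i, P i -> A (x i)) -> (hull P x `<=` A)%classic.
Proof.
move=> cA Ax _ [w [w0 w1 ->]].
have wN i : ~~ P i -> w 0 i = 0.
  by move=> /negPf Pi; have := w0 i; rewrite Pi -eq_le => /eqP.
rewrite (bigID P) /= [X in _ + X]big1 ?addr0 => [|i /wN ->]; last first.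
  by rewrite scale0r.
apply: convex_sum => // [i Pi|]; first by case/andP: (w0 i).
by rewrite -w1 [RHS](bigID P) /= [X in _ + X]big1 ?addr0.
Qed.

Lemma exists_sqnorm_min (R : realType) (d : nat) (I : finType)
    (D : I -> set 'rV[R]_d) (J : {set I}) :
  (forall i, compact (D i)) -> J != set0 -> intersecting D J ->
  exists p, (forall i, i \in J -> D i p) /\
    forall z, (forall i, i \in J -> D i z) -> sqnorm p <= sqnorm z.
Proof.
move=> cD /set0Pn[i0 iJ] ne.
have cK : compact (\bigcap_(i in [set` J]) D i)%classic.
  apply: (@subclosed_compact _ _ (D i0)) => //.
    apply: closed_bigI => i _; exact: compact_closed.
  by move=> z; apply.
have [|p /set_mem Kp pmin] := EVT_min_rV ne cK (f := @sqnorm R d).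
  by apply: continuous_subspaceT; exact: continuous_sqnorm.
exists p; split=> [i|z Kz]; first exact: Kp.
by apply: pmin; apply: mem_set => i; exact: Kz.
Qed.

(** Choose a point [x J] for every intersecting [J], and let [D i] be the hull of those [x J] with
    [i] in [J]; then [x J] lies in every [D i] with [i] in [J]. *)
Lemma compact_shrinking (R : realType) (d : nat) (I : finType)
    (C : I -> set 'rV[R]_d) :
  (forall i, convex_set (C i)) ->
  exists D : I -> set 'rV[R]_d, [/\ forall i, convex_set (D i),
    forall i, compact (D i), forall i, (D i `<=` C i)%classic &
    forall J : {set I}, intersecting C J -> intersecting D J].
Proof.
move=> cC.
have /choice[x xP] (J : {set I}) : exists z,
    intersecting C J -> forall i, i \in J -> C i z.
  have [[z zP]|nJ] := pselect (intersecting C J); last by exists 0.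
  by exists z => _ i; exact: zP.
pose P i (u : 'I_#|{set I}|) :=
  `[< intersecting C (enum_val u) >] && (i \in enum_val u).
exists (fun i => hull (P i) (fun u => x (enum_val u))); split=> [i|i|i|J CJ].
- exact: convex_hull.
- exact: compact_hull.
- by apply: hull_sub => // u /andP[/asboolP Cu iu]; exact: xP.
- exists (x J) => i iJ; rewrite -(enum_rankK J).
  by apply: mem_hull; rewrite /P enum_rankK; apply/andP; split=> //; apply/asboolP.
Qed.

(** * The extremal argument for compact convex sets *)

Lemma compact_colorful_helly (R : realType) (d r m k : nat) (I : finType)
    (D : I -> set 'rV[R]_d) (c : I -> 'I_r) :
  (m <= k)%N -> (k <= m + d)%N -> (k <= r)%N -> (m + d <= #|I|)%N ->
  (forall j, exists i, c i = j) ->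
  (forall i, convex_set (D i)) -> (forall i, compact (D i)) ->
  (forall A B : {set I}, spread c d m k A B ->
    exists2 b, b \in B & intersecting D (b |: A)) ->
  exists2 S : {set 'I_r}, #|S| = (r - k + 1)%N &
    intersecting D (color_union c S).
Proof.
move=> lemk lekmd lekr leI c_onto cD kD hyp.
(* Some spread pair exists, so the maximum is over a nonempty set; [i0] is a default value for
   [f]. *)
have [||||A0 [B0 [sAB0 _ _]]] := @exists_spread I r c d m k set0 setT lemk lekmd leI.
- by rewrite cards0.
- by rewrite -setI_eq0 set0I.
- rewrite /num_colors (_ : c @: setT = setT) ?cardsT ?card_ord //.
  by apply/setP => j; rewrite inE; have [i <-] := c_onto j; exact: imset_f.
- by rewrite cards0 add0n /num_colors imset0 cards0 addn0.
have [i0 _ _] := hyp _ _ sAB0.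
have /choice[p pP] (J : {set I}) : exists p, J != set0 -> intersecting D J ->
    (forall i, i \in J -> D i p) /\
    forall z, (forall i, i \in J -> D i z) -> sqnorm p <= sqnorm z.
  have [[J0 DJ]|nJ] := pselect (J != set0 /\ intersecting D J).
    by have [p pP] := exists_sqnorm_min kD J0 DJ; exists p.
  by exists 0 => J0 DJ; case: nJ.
pose ht J := sqnorm (p J).
(* Sets [b |: A] that are not intersecting are left out of the minimum, as if their height were
   infinite; [hyp] guarantees that one remains. *)
have /choice[f fP] (AB : {set I} * {set I}) : exists b, spread c d m k AB.1 AB.2 ->
    [/\ b \in AB.2, intersecting D (b |: AB.1) &
      forall b', b' \in AB.2 -> intersecting D (b' |: AB.1) ->
        ht (b |: AB.1) <= ht (b' |: AB.1)].
  have [sAB|] := boolP (spread c d m k AB.1 AB.2); last by exists i0.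
  have [b1 b1B Db1] := hyp _ _ sAB.
  pose P b := (b \in AB.2) && `[< intersecting D (b |: AB.1) >].
  have Pb1 : P b1 by rewrite /P b1B; apply/asboolP.
  case: (arg_minP (fun b => ht (b |: AB.1)) Pb1) => b /andP[bB /asboolP Db] bmin.
  exists b => _; split=> // b' b'B Db'; apply: bmin.
  by rewrite /P b'B; apply/asboolP.
have sAB0' : spread c d m k (A0, B0).1 (A0, B0).2 by [].
case: (arg_maxP (P := fun AB => spread c d m k AB.1 AB.2)
  (fun AB => ht (f AB |: AB.1)) sAB0') => [[A B] /= sAB ABmax].
set b := f (A, B) in ABmax *; pose J := b |: A.
have [/= bB DJ _] := fP (A, B) sAB; rewrite -/b -/J in bB DJ.
have neU (b' : I) (A' : {set I}) : b' |: A' != set0.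
  by apply/set0Pn; exists b'; rewrite setU11.
have [pJ pmin] := pP J (neU _ _) DJ.
(* The open ball of squared radius [ht J] misses the intersection over [J], so it already misses the
   one over some [L] of size at most d. *)
have [|L [sLJ cL Lt]] := relative_helly cD (@convex_sqnorm_ball R d (ht J)) DJ.
  by move=> z /pmin; rewrite leNgt => /negP.
pose M := [set i | `[< D i (p J) >]].
have [ltk|lek] := ltnP (num_colors c (~: M)) k.
  have [S cS] := exists_avoided_colors lekr ltk; rewrite setCK => /subsetP sS.
  by exists S => //; exists (p J) => i /sS; rewrite inE => /asboolP.
have sJM : J \subset M.
  by apply/subsetP => i iJ; rewrite inE; apply/asboolP; exact: pJ.
have dLM : [disjoint L & ~: M].
  by rewrite -setI_eq0 -setDE setD_eq0 (subset_trans sLJ).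
have sLAB : L \subset A :|: B.
  apply: (subset_trans sLJ); rewrite subUset sub1set inE bB orbT.
  exact: subsetUl.
have [A' [B' [sAB' sLA' sB'M]]] := exists_spread lemk lekmd leI cL dLM lek
  (spread_subset_bound sAB sLAB).
have [/= b'B' DJ' _] := fP (A', B') sAB'.
have /= := ABmax (A', B') sAB'; rewrite -/J.
set b' := f (A', B') in b'B' DJ' *; set J' := b' |: A' in DJ' * => le_ht.
have [pJ' _] := pP J' (neU _ _) DJ'.
(* Both points lie in all members of [L], as [L] is contained in [J] and in [A']; maximality bounds
   the squared norm of [p J'] by [ht J]. *)
have eqp : p J = p J'.
  apply: (@sqnorm_min_unique R d (\bigcap_(i in [set` L]) D i)%classic (ht J)).
  - apply/convex_setP => x y s t Lx Ly s0 t0 st1 i iL.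
    by move/convex_setP: (cD i); apply=> //; [exact: Lx|exact: Ly].
  - by move=> z Lz; rewrite leNgt; apply/negP; exact: Lt.
  - by move=> i /(subsetP sLJ); exact: pJ.
  - by move=> i /(subsetP sLA') iA'; apply: pJ'; rewrite inE iA' orbT.
  - exact: lexx.
  - exact: le_ht.
have := subsetP sB'M b' b'B'; rewrite !inE => /asboolP[].
by rewrite eqp; apply: pJ'; rewrite setU11.
Qed.

Local Close Scope ring_scope.

Theorem theorem1p8 (R : realType) (d r m k : nat)
    (hd : 1 <= d) (hr : d + 1 <= r)
    (hm : 1 <= m) (hmr : m <= r)
    (hmk : m <= k) (hk : k <= minn (m + d) r)
    (I : finType) (C : I -> set 'rV[R]_d) (c : I -> 'I_r)
    (c_onto : forall j : 'I_r, exists i : I, c i = j)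
    (C_convex : forall i : I, convex_set (C i))
    (C_card : maxn (m + d) r <= #|I|)
    (hyp : forall A B : {set I},
        #|A| = d -> #|B| = m -> [disjoint A & B] ->
        k <= num_colors c (A :|: B) ->
        exists2 b : I, b \in B & intersecting C (b |: A)) :
  exists2 S : {set 'I_r}, #|S| = r - k + 1 &
    intersecting C (color_union c S).
Proof.
(* [CD] carries the hypothesis over to the shrunken sets, and [sDC] carries the conclusion back. *)
have [D [cD kD sDC CD]] := compact_shrinking C_convex.
move: hk C_card; rewrite leq_min geq_max => /andP[lekmd lekr] /andP[leI _].
have [|S cS [z zS]] := compact_colorful_helly hmk lekmd lekr leI c_onto cD kD.
  move=> A B /and4P[/eqP cA /eqP cB dAB kAB].
  by have [b bB /CD] := hyp A B cA cB dAB kAB; exists b.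
by exists S => //; exists z => i iS; apply: sDC; exact: zS.
Qed.
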